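(* Let $n \geqslant 2$ be an integer and let $p$ be a prime such that $\gcd(p,2n+1)=1$. Then there exists a finite transitive permutation group $G$ such that $\Sigma(G)$ is (isomorphic to) the wreath graph $W(2n+1,p^n)$.
   Context: A base for a permutation group $G\leqslant \mathrm{Sym}(\Omega)$ is a subset of $\Omega$ whose pointwise stabiliser in $G$ is trivial. The Saxl graph $\Sigma(G)$ has vertex set $\Omega$, with two (distinct) vertices adjacent if and only if they form a base for $G$. For positive integers $n,k$, the wreath graph $W(n,k)$ is the graph with vertex set $\mathbb{Z}_k\times \mathbb{Z}_n$ such that $\{(a,i),(b,j)\}$ is an edge if and only if $j\equiv i\pm 1 \pmod n$. *)

(* Defs.v *)
From mathcomp Require Import all_boot all_fingroup.

Set Implicit Arguments.
Unset Strict Implicit.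
Unset Printing Implicit Defensive.

Local Open Scope group_scope.

Definition is_base (T : finType) (G : {group {perm T}}) (B : {set T}) : bool :=
  'C_G(B | 'P) == 1.

(* Graphs are given by their adjacency relation on a finite vertex type. *)
Definition saxl_graph (T : finType) (G : {group {perm T}}) : rel T :=
  [rel x y | (x != y) && is_base G [set x; y]].

(* Z_k x Z_n is represented by 'I_k * 'I_n, as 'Z_n is not the ring of
   integers mod n when n = 1. The disjuncts say j = i + 1 and j = i - 1 mod n;
   the condition u != v (edges are 2-sets) only matters when n = 1. *)
Definition wreath_graph (n k : nat) : rel ('I_k * 'I_n) :=
  [rel u v : 'I_k * 'I_n | (u != v) &&
    ((v.2 == u.2.+1 %[mod n]) || (v.2.+1 == u.2 %[mod n]))].
Arguments wreath_graph : clear implicits.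

Definition graph_isomorphic (S T : finType) (e : rel S) (f : rel T) : Prop :=
  exists2 h : S -> T, bijective h & {mono h : x y / e x y >-> f x y}.

(* Main.v *)
Require Import Defs.
From mathcomp Require Import all_boot all_fingroup all_algebra.

(** Let [A] be a nontrivial finite abelian group and let [V] be the group of
    zero-sum functions [v : Z_(2n+1) -> A].  On [A^n * Z_(2n+1)], let [v] in [V]
    act by adding to [w] in the fibre over [i] the restriction of [v] to
    [I_i = {i, i+2, ..., i+2(n-1)}], and let [Z_(2n+1)] act by rotating the
    fibres.  These maps form a transitive group.  An element fixing points over
    [i] and [j] is given by some [v] vanishing on the union of [I_i] and [I_j].
    If [j = i + 1] or [j = i - 1], this union misses a single point, so [v = 0]
    because its sum vanishes.  Otherwise [I_i] and [I_j] meet, the union misses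
    two points [a] and [b], and [v] may take opposite nonzero values there. *)

Section ZeroSumGroup.

Import GRing.Theory.
Local Open Scope ring_scope.

Variables (n : nat) (A : finZmodType).

Let Z := 'I_(2 * n).+1.
Let T := ({ffun 'I_n -> A} * Z)%type.

Lemma inZpD (m a b : nat) : inZp (a + b) = inZp a + inZp b :> 'I_m.+1.
Proof. by apply: val_inj; rewrite /= modnDm. Qed.

Definition even_shift (i : Z) (k : 'I_n) : Z := i + inZp k.*2.

Definition translate_rotate (v : {ffun Z -> A}) (s : Z) (x : T) : T :=
  ([ffun k => x.1 k + v (even_shift x.2 k)], x.2 + s).

Lemma translate_rotate_inj v s : injective (translate_rotate v s).
Proof.
move=> [w i] [w' i'] eq_x; have /addIr eq_i := congr1 snd eq_x.
have /ffunP eq_w := congr1 fst eq_x; rewrite /= in eq_i; subst i'; congr (_, _).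
by apply/ffunP=> k; have := eq_w k; rewrite !ffunE => /addIr.
Qed.

Definition translate_rotate_perm v s := perm (translate_rotate_inj v s).

Definition zero_sum_set : {set {perm T}} :=
  [set translate_rotate_perm v s | v in [set v : {ffun Z -> A} | \sum_i v i == 0], s in [set: Z]].

Lemma zero_sum_group_set : group_set zero_sum_set.
Proof.
apply/group_setP; split.
  apply/imset2P; exists [ffun=> 0] 0; rewrite ?inE //.
    by rewrite big1 // => i _; rewrite ffunE.
  apply/permP=> -[w i]; rewrite perm1 permE; congr (_, _); last by rewrite /= addr0.
  by apply/ffunP=> k; rewrite !ffunE addr0.
move=> _ _ /imset2P[v s + _ ->] /imset2P[v' s' + _ ->]; rewrite !inE => /eqP v0 /eqP v'0.
(* The first map has already rotated the fibre by [s], so [v'] is read at [i + s]. Reindexing shows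
   that this shift keeps its sum zero. *)
apply/imset2P; exists [ffun i => v i + v' (i + s)] (s + s'); rewrite ?inE //.
  under eq_bigr do rewrite ffunE.
  rewrite big_split /= v0 add0r -[X in _ == X]v'0; apply/eqP.
  by rewrite [RHS](reindex_inj (addIr s)).
apply/permP=> -[w i]; rewrite permM !permE; congr (_, _); last by rewrite /= addrA.
by apply/ffunP=> k; rewrite !ffunE /= -addrA /even_shift addrAC.
Qed.

Canonical zero_sum_group := group zero_sum_group_set.

Lemma zero_sum_groupP g :
  reflect (exists2 v : {ffun Z -> A}, \sum_i v i = 0 &
            exists s, g = translate_rotate_perm v s) (g \in zero_sum_group).
Proof.
apply: (iffP imset2P) => [[v s + _ ->]|[v v0 [s ->]]].
  by rewrite inE => /eqP; exists v; last exists s.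
by exists v s; rewrite ?inE ?v0.
Qed.

(** For [k < n] the offset [2k] stays below the modulus [2n + 1], so no wrap-around occurs. *)
Lemma even_shift_inj i : injective (even_shift i).
Proof.
move=> k l /addrI/(congr1 val) /=; rewrite !modn_small => [/double_inj/val_inj //||];
by rewrite mul2n ltnS leq_double ltnW.
Qed.

(** The point [i + 2n] is [i - 1]; reaching it would take [k = n]. *)
Lemma even_shift_neq_pred i k : even_shift i k != i + inZp (2 * n).
Proof.
apply/eqP=> /addrI/(congr1 val) /= /eqP; rewrite !modn_small //.
  by rewrite mul2n eqn_leq !leq_double [(n <= k)%N]leqNgt ltn_ord andbF.
by rewrite mul2n ltnS leq_double ltnW.
Qed.

Lemma zero_sum_group_transitive : [transitive zero_sum_group, on [set: T] | 'P].
Proof.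
apply/imsetP; exists ([ffun=> 0], 0); first by rewrite inE.
apply/eqP; rewrite eqEsubset subsetT andbT; apply/subsetP=> -[w i] _.
pose e := even_shift 0.
pose last : Z := 0 + inZp (2 * n).
(* The last coordinate lies outside the image of [e], so it is free to absorb
   the sum of [w]. *)
pose v := [ffun j => if j == last then - \sum_k w k
                     else \sum_(k | e k == j) w k] : {ffun Z -> A}.
apply/orbitP; exists (translate_rotate_perm v i).
  apply/zero_sum_groupP; exists v; last by exists i.
  rewrite (bigD1 last) //= ffunE eqxx (eq_bigr (fun j => \sum_(k | e k == j) w k)).
    (* Grouping the indices [k] by the value [e k], which is never [last], turns the rest of the sum
       into the total of [w]. *)
    rewrite (partition_big e (fun j => j != last)) /=; first by rewrite addNr.
    by move=> k _; apply: even_shift_neq_pred.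
  by move=> j /negPf ne; rewrite ffunE ne.
rewrite /= apermE permE; congr (_, _); last by rewrite /= add0r.
apply/ffunP=> k; rewrite !ffunE add0r (negPf (even_shift_neq_pred _ _)).
by rewrite (big_pred1 k) // => l; rewrite /= (inj_eq (even_shift_inj 0)).
Qed.

(** The offset of [a] from [i] is less than [2n]: if even it is some [2k], if odd some [2k + 1],
    with [k < n] in both cases. *)
Lemma even_shift_cover i a : a != i + inZp (2 * n) ->
  exists k, a = even_shift i k \/ a = even_shift (i + inZp 1) k.
Proof.
move=> ne; pose d := a - i.
have def_a : a = i + inZp d by rewrite valZpK addrC subrK.
have lt_d : (d < 2 * n)%N.
  rewrite ltn_neqAle -ltnS ltn_ord andbT; apply: contraNneq ne => eq_d.
  by rewrite def_a eq_d.
have lt_k : (d./2 < n)%N by rewrite ltn_half_double -mul2n.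
exists (Ordinal lt_k); rewrite def_a /even_shift /= -[in inZp d](odd_double_half d).
by case: (odd d); [right; rewrite inZpD addrA | left].
Qed.

Definition window (i : Z) : {set Z} := [set even_shift i k | k : 'I_n].

Lemma card_window i : #|window i| = n.
Proof. by rewrite card_imset ?card_ord //; apply: even_shift_inj. Qed.

(** When the offset [d] from [i] to [j] is even, [j] itself is a common point: it starts its own
    window, and it lies in that of [i] unless [d = 2n], which would mean [i = j + 1]. *)
Lemma windows_meet (i j : Z) : (0 < n)%N -> j != i + inZp 1 -> i != j + inZp 1 ->
  exists a, a \in window i :&: window j.
Proof.
(* Since [2n + 1] is odd, an odd offset [d] one way gives the even offset [2n + 1 - d] the other
   way. *)
wlog ev : i j / ~~ odd (j - i)%R => [IH n0 ji ij|].
  case: (boolP (odd (j - i)%R)) => [od|]; last by move/IH; apply.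
  suff ev : ~~ odd (i - j)%R by have [a] := IH j i ev n0 ij ji; rewrite setIC; exists a.
  rewrite -opprB; move: (j - i) od => d od.
  have d_gt0 : (0 < d)%N by case: (nat_of_ord d) od.
  rewrite /= modn_small; last by rewrite ltn_subrL d_gt0.
  by rewrite oddB 1?ltnW //= od mul2n odd_double.
move=> n0 ji ij; set d := j - i in ev.
have def_j : j = i + inZp d by rewrite valZpK addrC subrK.
have d_half : d = d./2.*2 :> nat by rewrite -[LHS]odd_double_half (negPf ev).
have lt_k : (d./2 < n)%N.
  rewrite ltn_half_double -mul2n ltn_neqAle -ltnS ltn_ord andbT.
  apply: contraNneq ij => eq_d; rewrite def_j eq_d -addrA -inZpD addn1.
  by apply/eqP; rewrite (_ : inZp _ = 0) ?addr0 //; apply: val_inj; rewrite /= modnn.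
exists j; rewrite inE; apply/andP; split; apply/imsetP.
  by exists (Ordinal lt_k); rewrite // /even_shift /= -d_half.
exists (Ordinal n0); rewrite // /even_shift /=.
by rewrite (_ : inZp _ = 0) ?addr0 //; apply: val_inj.
Qed.

Lemma zero_sum_base_adjacent (x y : T) : y.2 = x.2 + inZp 1 ->
  is_base zero_sum_group [set x; y].
Proof.
move=> def_y; rewrite /is_base -subG1; apply/subsetP=> g.
rewrite !inE => /andP[/zero_sum_groupP[v v0 [s ->]] /andP[_ /subsetP fix_xy]].
have fixP z : z \in [set x; y] -> translate_rotate v s z = z.
  by move=> /fix_xy; rewrite inE /= apermE permE => /eqP.
have v_vanish z k : z \in [set x; y] -> v (even_shift z.2 k) = 0.
  move=> /fixP/(congr1 fst)/ffunP/(_ k); rewrite ffunE /= => eq_z.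
  by apply: (addrI (z.1 k)); rewrite eq_z addr0.
have s0 : s = 0.
  have /(congr1 snd) /= := fixP x (set21 _ _).
  by move=> eq_s; apply: (addrI x.2); rewrite eq_s addr0.
have off a : a != x.2 + inZp (2 * n) -> v a = 0.
  case/even_shift_cover=> k [->|->]; first by rewrite v_vanish ?set21.
  by rewrite -def_y v_vanish ?set22.
have v_eq0 a : v a = 0.
  have [->|/off//] := eqVneq a (x.2 + inZp (2 * n)).
  by move: v0; rewrite (bigD1 (x.2 + inZp (2 * n))) //= big1 ?addr0.
apply/eqP/permP=> -[w i]; rewrite perm1 permE /translate_rotate s0 addr0 /=.
by congr (_, _); apply/ffunP=> k; rewrite ffunE v_eq0 addr0.
Qed.

Lemma zero_sum_not_base (x y : T) : (0 < n)%N -> (1 < #|A|)%N ->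
  y.2 != x.2 + inZp 1 -> x.2 != y.2 + inZp 1 ->
  ~~ is_base zero_sum_group [set x; y].
Proof.
move=> n0 A_gt1 yx xy; set U := window x.2 :|: window y.2.
have /card_gt1P[a [b [aU bU ab]]] : (1 < #|~: U|)%N.
  have [c c_in] := windows_meet _ _ n0 yx xy.
  have cardUI := cardsUI (window x.2) (window y.2).
  rewrite !card_window addnn -mul2n -/U in cardUI.
  (* The windows have [2n] points counted with multiplicity, one less than [Z], so the complement of
     [U] has one point more than their intersection. *)
  have : (#|U| + #|~: U| = (#|U| + #|window x.2 :&: window y.2|).+1)%N.
    by rewrite cardsC card_ord cardUI.
  rewrite -addnS => /addnI->; rewrite ltnS.
  by apply/card_gt0P; exists c.
have [c c0] : exists c : A, c != 0.
  by case/card_gt1P: A_gt1 => c [d [_ _ cd]]; case: (eqVneq c 0) cd => [->|];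
     [exists d; rewrite eq_sym | exists c].
pose v := [ffun j => if j == a then c else if j == b then - c else 0] : {ffun Z -> A}.
have vU z k : z \in [set x; y] -> v (even_shift z.2 k) = 0.
  move=> zxy; have zU : even_shift z.2 k \in U.
    by case/set2P: zxy => ->; rewrite inE imset_f ?orbT.
  by rewrite ffunE !ifN //; apply: contraTneq zU => ->; move: aU bU; rewrite !inE.
have gG : translate_rotate_perm v 0 \in zero_sum_group.
  apply/zero_sum_groupP; exists v; last by exists 0.
  rewrite (bigD1 a) //= (bigD1 b) 1?eq_sym //= big1 => [|i /andP[/negPf ia /negPf ib]].
    by rewrite !ffunE eqxx [b == a]eq_sym (negPf ab) eqxx addr0 addrN.
  by rewrite ffunE ia ib.
apply/negP=> /eqP C1.
have : translate_rotate_perm v 0 \in 'C_zero_sum_group([set x; y] | 'P)%g.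
  rewrite inE gG; apply/astabP=> z zxy; rewrite /= apermE permE.
  case: z zxy => w i zxy; congr (_, _); last by rewrite /= addr0.
  by apply/ffunP=> k; rewrite ffunE (vU (w, i)) // addr0.
rewrite C1 => /set1P g1.
have k0 : 'I_n := Ordinal n0.
(* The fibre is chosen so that its coordinate [k0] is translated by [v a = c], which exhibits a
   moved point. *)
have := congr1 (fun g : {perm T} => (g ([ffun=> 0], a - inZp k0.*2)).1 k0) g1.
rewrite perm1 permE /= !ffunE /= /even_shift subrK eqxx add0r => c_eq0.
by rewrite c_eq0 eqxx in c0.
Qed.

Lemma zero_sum_baseE (x y : T) : (0 < n)%N -> (1 < #|A|)%N ->
  is_base zero_sum_group [set x; y] =
    (y.2 == x.2 + inZp 1) || (x.2 == y.2 + inZp 1).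
Proof.
move=> n0 A_gt1; case: eqVneq => [/zero_sum_base_adjacent //|yx].
case: eqVneq => [/zero_sum_base_adjacent|xy]; first by rewrite setUC.
by apply/negbTE/zero_sum_not_base.
Qed.

Lemma saxl_zero_sum_group : (0 < n)%N -> (1 < #|A|)%N ->
  graph_isomorphic (saxl_graph zero_sum_group)
                   (wreath_graph (2 * n).+1 (#|A| ^ n)).
Proof.
move=> n0 A_gt1.
have card_w : #|{ffun 'I_n -> A}| = (#|A| ^ n)%N by rewrite card_ffun card_ord.
(* Apart from the condition that vertices differ, adjacency depends on the fibres alone, so any
   bijection will do on the first coordinate. *)
pose h (x : T) := (cast_ord card_w (enum_rank x.1), x.2).
have h_bij : bijective h.
  exists (fun u => (enum_val (cast_ord (esym card_w) u.1), u.2)) => -[w i] /=.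
    by rewrite /h /= cast_ordK enum_rankK.
  by rewrite /h /= enum_valK cast_ordKV.
exists h => // x y; rewrite /saxl_graph /wreath_graph /= (bij_eq h_bij).
have succE (i j : Z) : (j == i + inZp 1) = (j == i.+1 %[mod (2 * n).+1]).
  by rewrite -val_eqE /= modnDmr addn1 [in RHS]modn_small.
by rewrite zero_sum_baseE // !succE; congr (_ && (_ || _)); apply: eq_sym.
Qed.

End ZeroSumGroup.

Theorem proposition4p2 (n p : nat) (hn : 2 <= n) (hp : prime p)
    (hpn : gcdn p (2 * n + 1) = 1) :
  exists (T : finType) (G : {group {perm T}}),
    [transitive G, on [set: T] | 'P] /\
    graph_isomorphic (saxl_graph G) (wreath_graph (2 * n + 1) (p ^ n)).
Proof.
have n_gt0 : 0 < n by apply: ltnW.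
(* The type ['Z_p] always has at least two elements; its order is exactly [p] because [p > 1]. *)
have card_Zp : #|'Z_p| = p by rewrite card_ord Zp_cast ?prime_gt1.
rewrite addn1; exists ({ffun 'I_n -> 'Z_p} * 'I_(2 * n).+1)%type, (zero_sum_group n 'Z_p).
split; first exact: zero_sum_group_transitive.
by have := saxl_zero_sum_group n 'Z_p; rewrite card_Zp; apply; rewrite ?prime_gt1.
Qed.
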